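(* There is no integer $k$ such that the class of finite $1$-planar graphs has Assouad–Nagata dimension at most $k$.
   Context: A graph is $1$-planar if it can be drawn in the plane with at most one crossing on each edge. Graphs are unweighted metric spaces with the shortest-path distance. For a metric space $(X,d)$, a family $\mathcal U$ of subsets is $D$-bounded if every member has diameter at most $D$, and $r$-disjoint if points in different members are at distance $>r$. A function $D:\mathbb{R}^+\to\mathbb{R}^+$ is an $n$-dimensional control function for $X$ if for every $r>0$ there is a cover $\mathcal U=\mathcal U_1\cup\dots\cup\mathcal U_{n+1}$ of $X$ with each $\mathcal U_i$ $r$-disjoint and each member $D(r)$-bounded. A class has Assouad–Nagata dimension at most $n$ if there is a constant $c>0$ such that $D(r)=cr$ is an $n$-dimensional control function for every member. *)

(* Defs.v *)
From mathcomp Require Import all_boot.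
From Stdlib Require Import Reals.

Set Implicit Arguments.
Unset Strict Implicit.
Unset Printing Implicit Defensive.

Definition simple_graph (T : finType) (e : rel T) : Prop :=
  symmetric e /\ irreflexive e.

(* d(x,y) <= D : there is a walk from x to y with at most D edges.
   (d(x,y) = +oo if x,y are in different components.) *)
Definition gdist_le (T : finType) (e : rel T) (x y : T) (D : R) : Prop :=
  exists p : seq T, path e x p /\ last x p = y /\ (INR (size p) <= D)%R.

Definition bounded_set (T : finType) (e : rel T) (D : R) (U : {set T}) : Prop :=
  forall x y, x \in U -> y \in U -> gdist_le e x y D.

Definition r_disjoint (T : finType) (e : rel T) (r : R) (F : {set {set T}}) : Prop :=
  forall U V x y, U \in F -> V \in F -> U <> V -> x \in U -> y \in V ->
    ~ gdist_le e x y r.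

Definition control_function (n : nat) (T : finType) (e : rel T) (D : R -> R) : Prop :=
  forall r : R, (0 < r)%R ->
    exists Fs : 'I_n.+1 -> {set {set T}},
      (forall x : T, exists i U, U \in Fs i /\ x \in U) /\
      (forall i, r_disjoint e r (Fs i)) /\
      (forall i U, U \in Fs i -> bounded_set e (D r) U).

(* A drawing of (T,e) in the plane R^2: vertices are sent injectively to
   points, each edge xy is a simple arc (continuous injective curve on [0,1],
   given by coordinate functions) from the point of x to the point of y,
   whose interior avoids all vertex points; the arc for yx is the reverse of
   the arc for xy (so an edge is an unordered object). *)
Record drawing (T : finType) (e : rel T) := Drawing {
  vx : T -> R;  vy : T -> R;
  ax : T -> T -> R -> R;  ay : T -> T -> R -> R;
  vert_inj : forall u v, vx u = vx v -> vy u = vy v -> u = v;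
  arc_start : forall u v, e u v -> ax u v 0 = vx u /\ ay u v 0 = vy u;
  arc_end : forall u v, e u v -> ax u v 1 = vx v /\ ay u v 1 = vy v;
  arc_cont : forall u v t, e u v -> (0 <= t <= 1)%R ->
    continuity_pt (ax u v) t /\ continuity_pt (ay u v) t;
  arc_inj : forall u v s t, e u v -> (0 <= s <= 1)%R -> (0 <= t <= 1)%R ->
    ax u v s = ax u v t -> ay u v s = ay u v t -> s = t;
  arc_rev : forall u v t, e u v ->
    ax v u t = ax u v (1 - t) /\ ay v u t = ay u v (1 - t);
  arc_avoid : forall u v w t, e u v -> (0 < t < 1)%R ->
    ~ (ax u v t = vx w /\ ay u v t = vy w)
}.

Definition same_edge (T : Type) (x y u w : T) : Prop :=
  (u = x /\ w = y) \/ (u = y /\ w = x).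

Definition crosses_at (T : finType) (e : rel T) (d : drawing e)
    (x y u w : T) (s : R) : Prop :=
  e u w /\ ~ same_edge x y u w /\ (0 < s < 1)%R /\
  exists t, (0 < t < 1)%R /\
    ax d x y s = ax d u w t /\ ay d x y s = ay d u w t.

Definition one_planar_drawing (T : finType) (e : rel T) (d : drawing e) : Prop :=
  forall x y u w u' w' s s', e x y ->
    crosses_at d x y u w s -> crosses_at d x y u' w' s' ->
    s = s' /\ same_edge u w u' w'.

Definition one_planar (T : finType) (e : rel T) : Prop :=
  exists d : drawing e, one_planar_drawing d.

Definition AN_dim_le (C : forall T : finType, rel T -> Prop) (n : nat) : Prop :=
  exists c : R, (0 < c)%R /\
    forall (T : finType) (e : rel T), C T e ->
      control_function n e (fun r => (c * r)%R).

Definition finite_one_planar_graph (T : finType) (e : rel T) : Prop :=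
  simple_graph e /\ one_planar e.

(* Main.v *)
Require Import Defs.
From mathcomp Require Import all_boot.
From Stdlib Require Import Reals Lra Lia.

(** The words of length [N] over the alphabet [{0, ..., m}], two words being
    adjacent when all their letters differ by at most one, form a graph in which
    every combinatorial line is a path of length [m] and a geodesic, since the
    coordinates are 1-Lipschitz. By the Hales-Jewett theorem every colouring of a
    suitable such graph by [k + 1] colours has a monochromatic line, so with
    [m > c] there is no cover by [k + 1] families that are 1-disjoint and
    [c]-bounded. Subdividing every edge into the same number [L] of pieces only
    rescales the metric, and defeats covers at scale [L] instead.

    A uniform subdivision of any graph is 1-planar if it is fine enough. Put the
    vertices at integer points of the horizontal axis and draw the [i]-th edge as a
    trapezoid of height [i] whose sloped sides span horizontal distance 1/2. At a
    common point of two edges the higher one is sloped and the lower one is flat,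
    hence there are no triple points, and all crossings occur at rational
    parameters with a common denominator [Q]; cutting each edge at the odd
    multiples of [1 / 2Q] separates the crossings. *)

Set Implicit Arguments.
Unset Strict Implicit.
Unset Printing Implicit Defensive.

(** * The Hales-Jewett theorem by colour focusing *)

Section HalesJewett.

Variable m : nat.
Local Notation A := 'I_m.+1.
Implicit Types I J K : finType.

(** [None] marks the moving coordinates of a line. *)
Definition subst_line I (l : {ffun I -> option A}) (a : A) : {ffun I -> A} :=
  [ffun i => odflt a (l i)].

Definition fixed_line I (w : {ffun I -> A}) : {ffun I -> option A} :=
  [ffun i => Some (w i)].

Definition join I J B (x : {ffun I -> B}) (y : {ffun J -> B}) :
    {ffun I + J -> B} :=
  [ffun k => match k with inl i => x i | inr j => y j end].

Lemma subst_fixed I (w : {ffun I -> A}) a : subst_line (fixed_line w) a = w.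
Proof. by apply/ffunP=> i; rewrite !ffunE. Qed.

Lemma subst_join I J (l : {ffun I -> option A}) (l' : {ffun J -> option A}) a :
  subst_line (join l l') a = join (subst_line l a) (subst_line l' a).
Proof. by apply/ffunP=> -[i|j]; rewrite !ffunE. Qed.

Definition active I (l : {ffun I -> option A}) := [exists i, l i == None].

Lemma active_joinl I J (l : {ffun I -> option A}) (l' : {ffun J -> option A}) :
  active l -> active (join l l').
Proof. by case/existsP=> i li; apply/existsP; exists (inl i); rewrite ffunE. Qed.

Lemma active_joinr I J (l : {ffun I -> option A}) (l' : {ffun J -> option A}) :
  active l' -> active (join l l').
Proof. by case/existsP=> i li; apply/existsP; exists (inr i); rewrite ffunE. Qed.

Definition mono_below I K (chi : {ffun I -> A} -> K) t
    (l : {ffun I -> option A}) (c : K) :=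
  active l /\ forall a : A, a < t -> chi (subst_line l a) = c.

(* Only the moving letter is restricted to be smaller than [t]; the fixed
   letters of the line range over the whole alphabet, so that the alphabet
   stays the same along the induction on [t]. *)
Definition line_ramsey t K := exists I, forall chi : {ffun I -> A} -> K,
  exists l c, mono_below chi t l c.

Definition focused I K (chi : {ffun I -> A} -> K) t (z : A)
    (f : {ffun I -> A}) (s : seq ({ffun I -> option A} * K)) :=
  uniq [seq p.2 | p <- s] /\
  forall p, p \in s -> mono_below chi t p.1 p.2 /\ subst_line p.1 z = f.

(** Induction on [r]: colouring a second block [J] by whole colourings of the first block [I] gives
    a line [l'] along which the induced colouring [D] of [I] is constant below [t]; this yields one
    more focused line. *)
Lemma color_focusing t (z : A) K : 0 < t -> nat_of_ord z = t ->
  (forall K', line_ramsey t K') ->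
  forall r, exists I, forall chi : {ffun I -> A} -> K,
    (exists l c, mono_below chi t.+1 l c) \/
    exists f s, size s = r /\ focused chi t z f s.
Proof.
move=> t0 zt IH; elim=> [|r [I HI]].
  by exists unit => chi; right; exists [ffun=> z], [::].
have [J HJ] := IH {ffun {ffun I -> A} -> K}.
exists (I + J)%type => chi.
have [l' [D [act' monoD]]] := HJ (fun w' => [ffun w => chi (join w w')]).
have DE w (a : A) : a < t -> chi (join w (subst_line l' a)) = D w.
  by move=> lat; rewrite -(monoD a lat) ffunE.
(* Freezing the second block at letter [ord0] of [l'], which is below [t] by [t0], turns a line for
   [D] into one for [chi]. *)
have lift l c : mono_below D t.+1 l c -> exists l1 c1, mono_below chi t.+1 l1 c1.
  case=> actl Hl; exists (join l (fixed_line (subst_line l' ord0))), c.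
  split=> [|a lat]; first exact: active_joinl.
  by rewrite subst_join subst_fixed DE ?Hl.
case: (HI D) => [[l [c H]]|[f [s [sz [us Hs]]]]]; first by left; apply: lift H.
(* If the focus has the colour of a line in [s], that line stays monochromatic at letter [z]. *)
case: (boolP (D f \in [seq p.2 | p <- s])) => [/mapP[p ps Dp]|nD].
  left; have [[actp Hp] fp] := Hs p ps.
  apply: (lift p.1 p.2); split=> // a; rewrite ltnS leq_eqVlt => /orP[/eqP at_|].
    by have -> : a = z; [apply: val_inj; rewrite /= at_ zt | rewrite fp].
  exact: Hp.
(* A new colour: the line moving only in [J] joins the old lines, which now move in both blocks; all
   meet at the new focus. *)
right; exists (join f (subst_line l' z)).
exists ((join (fixed_line f) l', D f) :: [seq (join p.1 l', p.2) | p <- s]).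
rewrite /= size_map sz; split=> //; split.
  by rewrite /= -map_comp [X in X \notin _]/= nD.
move=> p; rewrite inE => /orP[/eqP->|/mapP[q qs ->]] /=.
  split; last by rewrite subst_join subst_fixed.
  split=> [|a lat]; first exact: active_joinr.
  by rewrite subst_join subst_fixed DE.
have [[actq Hq] fq] := Hs q qs.
split; last by rewrite subst_join fq.
split=> [|a lat]; first exact: active_joinr.
by rewrite subst_join DE ?Hq.
Qed.

(** Induction on [t]: more focused lines than colours cannot exist, so focusing must produce the
    longer monochromatic line. *)
Lemma line_ramsey_leq t K : t < m.+1 -> line_ramsey t.+1 K.
Proof.
elim: t K => [|t IH] K ltm.
  exists unit => chi; exists [ffun=> None], (chi [ffun=> ord0]); split.
    by apply/existsP; exists tt; rewrite ffunE.
  move=> a; rewrite ltnS leqn0 => /eqP a0; congr chi.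
  by apply/ffunP=> i; rewrite !ffunE /=; apply: val_inj.
have [I HI] := @color_focusing t.+1 (Ordinal ltm) K isT erefl
  (fun K' => IH K' (ltnW ltm)) #|K|.+1.
exists I => chi; case: (HI chi) => // -[f [s [sz [us _]]]].
by have := max_card (mem [seq p.2 | p <- s]); rewrite (card_uniqP us) size_map sz ltnn.
Qed.

Theorem hales_jewett K : exists I, forall chi : {ffun I -> A} -> K,
  exists l, active l /\ forall a b, chi (subst_line l a) = chi (subst_line l b).
Proof.
have [I HI] := line_ramsey_leq K (ltnSn m).
exists I => chi; have [l [c [act Hl]]] := HI chi.
by exists l; split=> // a b; rewrite !Hl.
Qed.

End HalesJewett.

(** * Auxiliary facts on reals, continuity and walks *)

Lemma INR_ltn i j : i < j -> (INR i < INR j)%R.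
Proof. by move/ltP/lt_INR. Qed.

Lemma INR_leq i j : i <= j -> (INR i <= INR j)%R.
Proof. by move/leP/le_INR. Qed.

Lemma INR_lt_S_le i j : (INR i < INR j + 1)%R -> (INR i <= INR j)%R.
Proof. by rewrite -S_INR => /INR_lt/ltP; rewrite ltnS; apply: INR_leq. Qed.

Lemma IZR_eq_of_near (y z : Z) : (-1 < IZR y - IZR z < 1)%R -> y = z.
Proof. by rewrite -minus_IZR => -[/lt_IZR H1 /lt_IZR H2]; lia. Qed.

Lemma continuity_pt_ext (f g : R -> R) x :
  f =1 g -> continuity_pt f x -> continuity_pt g x.
Proof. by move=> fg; apply: (continuity_pt_locally_ext _ _ 1); [lra | move=> y _]. Qed.

Local Arguments INR : simpl never.

Lemma path_lipschitz (T : Type) (e : rel T) (g : T -> R) x p :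
  (forall x y, e x y -> (g y <= g x + 1)%R) -> path e x p ->
  (g (last x p) <= g x + INR (size p))%R.
Proof.
move=> lip; elim: p x => [|y p IH] x /=; first by rewrite INR_0; lra.
by case/andP=> /lip L /IH; rewrite S_INR; lra.
Qed.

(** * Edges drawn as trapezoids, and their intersections *)

Section Subdivision.

Variables (T : finType) (e : rel T).

(** For symmetric [e], each edge other than a loop occurs once, directed from left to right in the
    drawing. *)
Definition oriented_edge := {p : T * T | (enum_rank p.1 < enum_rank p.2) && e p.1 p.2}.

Implicit Types a b c : oriented_edge.

Definition src a : T := (val a).1.
Definition tgt a : T := (val a).2.
Definition pos (u : T) : R := INR (enum_rank u).
Definition height a : R := INR (enum_rank a).+1.
(** A multiple of twice any height times any horizontal edge length, the denominators that occur at
    crossings. *)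
Definition mesh : nat := 2 * #|{: oriented_edge}|`! * #|T|`!.

Definition trapezoid a (x : R) : R :=
  (height a * Rmin 1 (Rmin (2 * (x - pos (src a))) (2 * (pos (tgt a) - x))))%R.

Definition over a (x : R) : Prop := (pos (src a) < x < pos (tgt a))%R.

(* Crossings have integer values of this parameter, cut points half-integer
   ones. *)
Definition param a (x : R) : R :=
  (INR mesh * (x - pos (src a)) / (pos (tgt a) - pos (src a)))%R.

(** The [mesh] interior cuts make [mesh.+1] pieces; the two end pieces have parameter length 1/2,
    the others 1. *)
Definition cut (j : nat) : R :=
  if j == 0 then 0%R else if j <= mesh then (INR j - / 2)%R else INR mesh.

Definition cutx a (j : nat) : R :=
  (pos (src a) + (pos (tgt a) - pos (src a)) * cut j / INR mesh)%R.

Lemma edge_src_tgt a : e (src a) (tgt a).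
Proof. by case/andP: (valP a). Qed.

Lemma src_lt_tgt a : (pos (src a) < pos (tgt a))%R.
Proof. by case/andP: (valP a) => /INR_ltn. Qed.

Lemma pos_inj u v : pos u = pos v -> u = v.
Proof. by move/INR_eq/val_inj/enum_rank_inj. Qed.

Lemma height_inj a b : height a = height b -> a = b.
Proof. by move/INR_eq => -[] /val_inj/enum_rank_inj. Qed.

Lemma height_gt0 a : (0 < height a)%R.
Proof. exact: (@INR_ltn 0). Qed.

Lemma mesh_gt0 : 0 < mesh.
Proof. by rewrite /mesh !muln_gt0 !fact_gt0. Qed.

Lemma INR_mesh_gt0 : (0 < INR mesh)%R.
Proof. exact: (INR_ltn mesh_gt0). Qed.

Lemma trapezoid_gt0 a x : over a x -> (0 < trapezoid a x)%R.
Proof.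
case=> H1 H2; apply: Rmult_lt_0_compat; first exact: height_gt0.
by do 2!(apply: Rmin_glb_lt; first lra); lra.
Qed.

Lemma trapezoid_le a x : (trapezoid a x <= height a)%R.
Proof.
rewrite -[X in (_ <= X)%R]Rmult_1_r; apply: Rmult_le_compat_l.
  exact: Rlt_le (height_gt0 a).
exact: Rmin_l.
Qed.

Lemma trapezoid_src a : trapezoid a (pos (src a)) = 0%R.
Proof.
have := src_lt_tgt a => H; rewrite /trapezoid Rmin_right ?Rmin_left; lra.
Qed.

Lemma trapezoid_tgt a : trapezoid a (pos (tgt a)) = 0%R.
Proof.
have := src_lt_tgt a => H; rewrite /trapezoid Rmin_right ?Rmin_right; lra.
Qed.

Lemma trapezoid_continuous a x : continuity_pt (trapezoid a) x.
Proof.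
have cid : continuity_pt id x by apply: derivable_continuous_pt; apply: derivable_pt_id.
have cc (k : R) : continuity_pt (fun=> k) x by apply: continuity_pt_const.
apply: (continuity_pt_mult (fun=> height a)); first exact: cc.
have cmin f g : continuity_pt f x -> continuity_pt g x ->
    continuity_pt (fun y => Rmin (f y) (g y)) x.
  move=> cf cg.
  (* The minimum is half of the sum minus the absolute difference. *)
  apply: (@continuity_pt_ext (fun y => (f y + g y - Rabs (f y - g y)) * / 2)%R).
    move=> y; rewrite /Rmin; case: Rle_dec => H.
      by rewrite Rabs_left1; lra.
    by rewrite Rabs_right; lra.
  apply: (continuity_pt_mult _ (fun=> (/2)%R)) => //.
  apply: (continuity_pt_minus (fun y => f y + g y)%R (fun y => Rabs (f y - g y))).
    exact: continuity_pt_plus.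
  apply: (continuity_pt_comp (fun y => f y - g y)%R Rabs).
    exact: continuity_pt_minus.
  exact: Rcontinuity_abs.
apply: (cmin (fun=> 1%R)) => //.
apply: (cmin (fun x => 2 * (x - pos (src a)))%R (fun x => 2 * (pos (tgt a) - x))%R).
  apply: (continuity_pt_mult (fun=> 2%R) (fun x => x - pos (src a))%R) => //.
  exact: (continuity_pt_minus id).
apply: (continuity_pt_mult (fun=> 2%R) (fun x => pos (tgt a) - x)%R) => //.
exact: (continuity_pt_minus _ id).
Qed.

Variant trapezoid_spec a x : Prop :=
| TrapFlat of trapezoid a x = height a
| TrapUp of trapezoid a x = (height a * (2 * (x - pos (src a))))%R &
    (x < pos (src a) + / 2)%R
| TrapDown of trapezoid a x = (height a * (2 * (pos (tgt a) - x)))%R &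
    (pos (tgt a) - / 2 < x)%R.

Lemma trapezoidP a x : trapezoid_spec a x.
Proof.
rewrite /trapezoid.
have [H1|H1] := Rle_or_lt 1 (Rmin (2 * (x - pos (src a))) (2 * (pos (tgt a) - x))).
  by apply: TrapFlat; rewrite /trapezoid Rmin_left // Rmult_1_r.
have [H2|H2] := Rle_or_lt (2 * (x - pos (src a))) (2 * (pos (tgt a) - x)).
  move: H1; rewrite (Rmin_left _ _ H2) => H1.
  by apply: TrapUp; [rewrite /trapezoid (Rmin_left _ _ H2) Rmin_right //|]; lra.
move: H1; rewrite (Rmin_right (2 * (x - pos (src a)))); last lra.
move=> H1; apply: TrapDown; last lra.
by rewrite /trapezoid (Rmin_right (2 * (x - pos (src a)))) ?Rmin_right; lra.
Qed.

Lemma pos_near u v (x : R) :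
  (Rabs (x - pos u) < / 2)%R -> (Rabs (x - pos v) < / 2)%R -> pos u = pos v.
Proof.
move=> /Rabs_def2 [H1 H2] /Rabs_def2 [H3 H4]; rewrite /pos in H1 H2 H3 H4 *.
by apply: Rle_antisym; apply: INR_lt_S_le; lra.
Qed.

(* Near a vertex, sloped pieces with different slopes emanate from that
   vertex, hence only meet the flat pieces. *)
Lemma trapezoid_meet a b x : over a x -> over b x -> (height b < height a)%R ->
  trapezoid a x = trapezoid b x ->
  trapezoid b x = height b /\
  exists z : Z, (2 * height a * x)%R = IZR z.
Proof.
move=> [a1 a2] [b1 b2] hlt E; have hb := height_gt0 b.
have le_b := trapezoid_le b x.
have near w : exists z, (2 * height a * pos w)%R = IZR z.
  rewrite /height /pos !INR_IZR_INZ -!mult_IZR; by eexists.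
have flat : trapezoid b x = height b.
  (* A flat [a] would be too high for [b]. If both are sloped, [x] is within 1/2 of a vertex of
     each, so these vertices coincide; a rising and a falling side lie on opposite sides of it. *)
  case: (trapezoidP a x) => [Ea|Ea La|Ea La]; first lra.
  - case: (trapezoidP b x) => // Eb Lb.
    + have P : pos (src a) = pos (src b).
        by apply: (@pos_near _ _ x); rewrite Rabs_right; lra.
      by rewrite P in Ea a1; nra.
    + have P : pos (src a) = pos (tgt b).
        by apply: (@pos_near _ _ x); [rewrite Rabs_right|rewrite Rabs_left]; lra.
      lra.
  - case: (trapezoidP b x) => // Eb Lb.
    + have P : pos (tgt a) = pos (src b).
        by apply: (@pos_near _ _ x); [rewrite Rabs_left|rewrite Rabs_right]; lra.
      lra.
    + have P : pos (tgt a) = pos (tgt b).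
        by apply: (@pos_near _ _ x); rewrite Rabs_left; lra.
      by rewrite P in Ea a2; nra.
(* Equating the sloped side of [a] with the integer height of [b] and solving for [2 * height a * x]
   leaves only integers. *)
split=> //; have hE : height b = IZR (Z.of_nat (enum_rank b).+1) by rewrite -INR_IZR_INZ.
case: (trapezoidP a x) => [Ea|Ea La|Ea La]; first lra.
- have [z Ez] := near (src a); exists (z + Z.of_nat (enum_rank b).+1)%Z.
  by rewrite plus_IZR -hE -Ez; lra.
- have [z Ez] := near (tgt a); exists (z - Z.of_nat (enum_rank b).+1)%Z.
  by rewrite minus_IZR -hE -Ez; lra.
Qed.

Lemma param_integral a b x : (exists z : Z, (2 * height b * x)%R = IZR z) ->
  exists z : Z, param a x = IZR z.
Proof.
case=> z Ez.
have /dvdnP[q Eq] : (enum_rank b).+1 %| #|{: oriented_edge}|`! by rewrite dvdn_fact //=.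
have dlt : enum_rank (src a) < enum_rank (tgt a) by case/andP: (valP a).
have /dvdnP[q' Eq'] : enum_rank (tgt a) - enum_rank (src a) %| #|T|`!.
  by rewrite dvdn_fact // subn_gt0 dlt /= (leq_trans (leq_subr _ _)) // ltnW.
(* [param a x] equals [q * q'] times [2 * height b * (x - pos (src a))]. *)
exists (Z.of_nat q * Z.of_nat q' *
  (z - 2 * Z.of_nat (enum_rank b).+1 * Z.of_nat (enum_rank (src a))))%Z.
have D := src_lt_tgt a.
have Ed : INR (enum_rank (tgt a) - enum_rank (src a)) = (pos (tgt a) - pos (src a))%R.
  by rewrite minus_INR //; apply/leP; apply: ltnW.
rewrite /param /mesh Eq Eq' -!multE !mult_INR Ed -/(height b).
rewrite !mult_IZR minus_IZR !mult_IZR -!INR_IZR_INZ -Ez -/(height b) -/(pos _).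
rewrite (S_INR 1) INR_1.
by field; lra.
Qed.

(** The higher edge makes [x] rational, and [param_integral] accepts either edge in that role. *)
Lemma meet_param a b x : over a x -> over b x -> a <> b ->
  trapezoid a x = trapezoid b x -> exists z : Z, param a x = IZR z.
Proof.
move=> oa ob ne E; have [lt|[eq|lt]] := Rtotal_order (height a) (height b).
- by have [_ /param_integral] := trapezoid_meet ob oa lt (esym E); apply.
- by case: ne; apply: height_inj.
- by have [_ /param_integral] := trapezoid_meet oa ob lt E; apply.
Qed.

(** Of three distinct heights, the middle edge would be flat, being below the highest, and thus out
    of reach of the lowest. *)
Lemma no_triple_point a b c x : over a x -> over b x -> over c x ->
  trapezoid a x = trapezoid b x -> trapezoid a x = trapezoid c x ->
  a <> b -> a <> c -> b = c.
Proof.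
move=> oa ob oc Eb Ec nb nc; apply: height_inj.
have nhb : height a <> height b by move/height_inj.
have nhc : height a <> height c by move/height_inj.
have chain p q r : over p x -> over q x -> trapezoid p x = trapezoid q x ->
    trapezoid q x = trapezoid r x -> (height q < height p)%R -> (height r < height q)%R ->
    False.
  move=> op oq E1 E2 l1 l2; have [flat _] := trapezoid_meet op oq l1 E1.
  by have := trapezoid_le r x; lra.
have Ebc : trapezoid b x = trapezoid c x by lra.
case: (Rtotal_order (height b) (height c)) => [l|[//|l]];
case: (Rtotal_order (height a) (height b)) => [l1|[//|l1]];
case: (Rtotal_order (height a) (height c)) => [l2|[//|l2]]; exfalso;
first [lra | by apply: (chain a b c) | by apply: (chain a c b)
  | by apply: (chain b a c) | by apply: (chain b c a) | by apply: (chain c a b)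
  | by apply: (chain c b a)].
Qed.

(** * Cut points and the pieces between them *)

Lemma cut_lt i j : i < j <= mesh.+1 -> (cut i < cut j)%R.
Proof.
case/andP=> lij lj; rewrite /cut.
have m0 := INR_ltn mesh_gt0; rewrite INR_0 in m0.
case: i lij => [|i] lij; case: j lij lj => [|j] lij lj //=.
  case: ifP => // _; have := INR_leq (ltn0Sn j); rewrite INR_1 => H; lra.
have -> : i < mesh by rewrite -ltnS (leq_trans lij).
case: ifP => H; first by have := INR_ltn lij; lra.
have : i.+1 <= mesh by rewrite -ltnS (leq_trans lij).
by move/INR_leq; lra.
Qed.

(** Such gaps leave room for at most one integer strictly inside a piece. *)
Lemma cut_succ_le j : (cut j.+1 <= cut j + 1)%R.
Proof.
have m1 := INR_leq mesh_gt0; rewrite INR_1 in m1.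
rewrite /cut /=; case: j => [|j] /=; first by rewrite mesh_gt0 INR_1; lra.
case: ifP => H; first by rewrite (ltnW H); rewrite (S_INR j.+1); lra.
case: ifP => H' //; last lra.
have : mesh = j.+1 by apply/eqP; rewrite eqn_leq H' leqNgt H.
by move->; lra.
Qed.

Lemma cut_not_integral j (z : Z) : 0 < j <= mesh -> cut j <> IZR z.
Proof.
rewrite /cut; case: j => //= j ->; rewrite INR_IZR_INZ => E.
have : (2 * Z.of_nat j.+1 - 1 = 2 * z)%Z.
  by apply: eq_IZR; rewrite minus_IZR !mult_IZR; lra.
by lia.
Qed.

Lemma cut0 : cut 0 = 0%R. Proof. by []. Qed.

Lemma cut_mesh : cut mesh.+1 = INR mesh.
Proof. by rewrite /cut /= ltnn. Qed.

Lemma param_cutx a j : param a (cutx a j) = cut j.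
Proof.
have D := src_lt_tgt a; have m0 := INR_mesh_gt0.
by rewrite /param /cutx; field; lra.
Qed.

Lemma param_lt a x y : (param a x < param a y)%R <-> (x < y)%R.
Proof.
have D := src_lt_tgt a; have m0 := INR_mesh_gt0.
have k0 : (0 < INR mesh / (pos (tgt a) - pos (src a)))%R by apply: Rdiv_lt_0_compat; lra.
have E w : param a w = (INR mesh / (pos (tgt a) - pos (src a)) * (w - pos (src a)))%R.
  by rewrite /param /Rdiv; lra.
rewrite !E; split=> H; last by apply: Rmult_lt_compat_l; lra.
by have := Rmult_lt_reg_l _ _ _ k0 H; lra.
Qed.

Lemma param_inj a x y : param a x = param a y -> x = y.
Proof.
move=> E; case: (Rtotal_order x y) => [l|[//|l]].
  by have := (param_lt a x y).2 l; lra.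
by have := (param_lt a y x).2 l; lra.
Qed.

Lemma cutx0 a : cutx a 0 = pos (src a).
Proof. by rewrite /cutx cut0; lra. Qed.

Lemma cutx_mesh a : cutx a mesh.+1 = pos (tgt a).
Proof. by have m0 := INR_mesh_gt0; rewrite /cutx cut_mesh; field; lra. Qed.

Lemma cutx_lt a i j : i < j <= mesh.+1 -> (cutx a i < cutx a j)%R.
Proof. by move=> H; apply/(param_lt a); rewrite !param_cutx; apply: cut_lt. Qed.

Lemma cutx_le a i j : i <= j <= mesh.+1 -> (cutx a i <= cutx a j)%R.
Proof.
case/andP; rewrite leq_eqVlt => /orP[/eqP->|lij] lj; first lra.
by apply/Rlt_le/cutx_lt; rewrite lij.
Qed.

Definition in_piece a j (x : R) : Prop := (cutx a j < x < cutx a j.+1)%R.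

Lemma in_piece_over a j x : j <= mesh -> in_piece a j x -> over a x.
Proof.
move=> jm [H1 H2]; have := @cutx_le a 0 j; have := @cutx_le a j.+1 mesh.+1.
by rewrite /over cutx0 cutx_mesh ltnS jm leqnn (leqW jm) => /(_ isT) ? /(_ isT) ?; lra.
Qed.

Lemma cutx_over a j : 0 < j <= mesh -> over a (cutx a j).
Proof.
case/andP=> j0 jm; rewrite /over -cutx0 -cutx_mesh.
by split; apply: cutx_lt; rewrite ?j0 ?ltnS ?jm ?leqnn ?(leqW jm).
Qed.

Lemma in_piece_uniq a i j x : i <= mesh -> j <= mesh ->
  in_piece a i x -> in_piece a j x -> i = j.
Proof.
move=> im jm [i1 i2] [j1 j2]; case: (ltngtP i j) => // l.
  by have := @cutx_le a i.+1 j; rewrite l (leqW jm) => /(_ isT); lra.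
by have := @cutx_le a j.+1 i; rewrite l (leqW im) => /(_ isT); lra.
Qed.

Lemma in_piece_cutx a i j : i <= mesh -> j <= mesh.+1 -> ~ in_piece a i (cutx a j).
Proof.
move=> im jm [H1 H2]; case: (leqP j i) => l.
  by have := @cutx_le a j i; rewrite l (leqW im) => /(_ isT); lra.
by have := @cutx_le a i.+1 j; rewrite l jm => /(_ isT); lra.
Qed.

(** Both crossings have integral parameters strictly between consecutive cuts, hence equal ones;
    [no_triple_point] then identifies the other edges. *)
Lemma crossing_uniq_in_piece a b c j x y : j <= mesh -> a <> b -> a <> c ->
  in_piece a j x -> in_piece a j y -> over b x -> over c y ->
  trapezoid a x = trapezoid b x -> trapezoid a y = trapezoid c y -> x = y /\ b = c.
Proof.
move=> jm nb nc px py ob oc Ex Ey.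
have ox := in_piece_over jm px; have oy := in_piece_over jm py.
have [z Ez] := meet_param ox ob nb Ex; have [z' Ez'] := meet_param oy oc nc Ey.
have xy : x = y.
  apply: (@param_inj a); rewrite Ez Ez'; congr IZR; apply: IZR_eq_of_near.
  case: px py => [/(param_lt a) x1 /(param_lt a) x2] [/(param_lt a) y1 /(param_lt a) y2].
  rewrite !param_cutx in x1 x2 y1 y2; have := cut_succ_le j; lra.
by subst y; split=> //; apply: (no_triple_point ox ob oc).
Qed.

Lemma cutx_not_crossing a b j : 0 < j <= mesh -> a <> b -> over b (cutx a j) ->
  trapezoid a (cutx a j) <> trapezoid b (cutx a j).
Proof.
move=> Hj ne ob E; have [z] := meet_param (cutx_over a Hj) ob ne E.
by rewrite param_cutx; apply: cut_not_integral.
Qed.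

(** * The subdivided graph *)

Definition subdivision : finType := (T + oriented_edge * 'I_mesh)%type.

Implicit Types x y : subdivision.

(** Indices of interior nodes are shifted by one, as the source is node 0; [insub] first fails at
    [j = mesh.+1], which gives the target. *)
Definition node a (j : nat) : subdivision :=
  if j is i.+1 then
    if insub i is Some i' then inr (a, i') else inl (tgt a)
  else inl (src a).

Definition sub_edge : rel subdivision := fun x y =>
  [exists a, exists j : 'I_mesh.+1,
     ((x == node a j) && (y == node a j.+1)) ||
     ((x == node a j.+1) && (y == node a j))].

Variant sub_edge_spec x y : Prop :=
  SubEdge a j of j <= mesh & same_edge (node a j) (node a j.+1) x y.

Lemma sub_edgeP x y : reflect (sub_edge_spec x y) (sub_edge x y).
Proof.
apply: (iffP existsP) => [[a /existsP[j]] | [a j jm H]].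
  have jm : j <= mesh by rewrite -ltnS.
  by case/orP=> /andP[/eqP-> /eqP->]; apply: (SubEdge jm); [left|right].
have jm' : j < mesh.+1 by rewrite ltnS.
exists a; apply/existsP; exists (Ordinal jm') => /=.
by case: H => -[-> ->]; rewrite !eqxx ?orbT.
Qed.

Lemma node_interior a (j : nat) (jm : j < mesh) : node a j.+1 = inr (a, Ordinal jm).
Proof. by rewrite /node insubT. Qed.

Lemma node_last a : node a mesh.+1 = inl (tgt a).
Proof. by rewrite /node insubF // ltnn. Qed.

Variant node_index_spec a : nat -> subdivision -> Prop :=
| NodeSrc : node_index_spec a 0 (inl (src a))
| NodeIn (i : 'I_mesh) : node_index_spec a i.+1 (inr (a, i))
| NodeTgt : node_index_spec a mesh.+1 (inl (tgt a)).

Lemma nodeP a j : j <= mesh.+1 -> node_index_spec a j (node a j).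
Proof.
case: j => [|j]; first by constructor.
rewrite ltnS leq_eqVlt => /orP[/eqP->|lt]; first by rewrite node_last; constructor.
by rewrite (node_interior _ lt); apply: (NodeIn a (Ordinal lt)).
Qed.

(** * The drawing of the subdivision *)

Definition px (x : subdivision) : R :=
  match x with inl u => pos u | inr (a, i) => cutx a i.+1 end.

Definition py (x : subdivision) : R :=
  match x with inl _ => 0%R | inr (a, i) => trapezoid a (cutx a i.+1) end.

(** Recovers the original edge from two consecutive nodes: as [mesh] is positive, one of them is a
    subdivision vertex, which records its edge. *)
Definition label (x y : subdivision) : option oriented_edge :=
  match x, y with
  | inr (a, _), _ => Some a | _, inr (a, _) => Some a | _, _ => None end.

(** Each arc is part of the graph of a trapezoid, parametrized affinely by the abscissa, so
    injectivity can be read off [arcx] alone. *)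
Definition arcx x y (t : R) : R := (px x + t * (px y - px x))%R.
Definition arcy x y (t : R) : R :=
  if label x y is Some a then trapezoid a (arcx x y t) else 0%R.

Lemma px_node a j : j <= mesh.+1 -> px (node a j) = cutx a j.
Proof. by case/(nodeP a) => //=; rewrite ?cutx0 ?cutx_mesh. Qed.

Lemma py_node a j : j <= mesh.+1 -> py (node a j) = trapezoid a (cutx a j).
Proof.
by case/(nodeP a) => //=; rewrite ?cutx0 ?cutx_mesh ?trapezoid_src ?trapezoid_tgt.
Qed.

Lemma label_node a j : j <= mesh -> label (node a j) (node a j.+1) = Some a /\
  label (node a j.+1) (node a j) = Some a.
Proof.
move=> jm; case: j jm => [|j] jm; first by rewrite (node_interior _ mesh_gt0).
by rewrite (node_interior _ jm); case: (nodeP a (jm : j.+2 <= mesh.+1)).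
Qed.

Variant sub_arc_spec x y : Prop :=
  SubArc a j of j <= mesh & same_edge (node a j) (node a j.+1) x y &
    (forall t, arcy x y t = trapezoid a (arcx x y t)) &
    (forall t, (0 < t < 1)%R -> in_piece a j (arcx x y t)) &
    py x = trapezoid a (px x) & py y = trapezoid a (px y) & px x <> px y.

Lemma sub_arcP x y : sub_edge x y -> sub_arc_spec x y.
Proof.
case/sub_edgeP=> a j jm S; have [l1 l2] := label_node a jm.
have lt := @cutx_lt a j j.+1; rewrite ltnS leqnn ltnS jm in lt; have {}lt := lt isT.
have jm1 := leqW jm.
have S' := S; case: S' => -[Ex Ey]; subst x y;
  apply: (SubArc jm S); rewrite /arcx /arcy ?l1 ?l2 ?px_node ?py_node //; try lra;
  by move=> t; rewrite /arcx ?px_node // => -[t1 t2]; rewrite /in_piece; split; nra.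
Qed.

Lemma sub_edge_sym : symmetric sub_edge.
Proof.
have H x y : sub_edge x y -> sub_edge y x.
  by case/sub_edgeP=> a j jm [] [-> ->]; apply/sub_edgeP; apply: (SubEdge jm); [right|left].
by move=> x y; apply/idP/idP; apply: H.
Qed.

Lemma sub_edge_irrefl : irreflexive sub_edge.
Proof. 
move=> x; case E: (sub_edge x x) => //.
by case: (sub_arcP E) => a j _ _ _ _ _ _.
Qed.

Lemma label_sym x y : sub_edge x y -> label x y = label y x.
Proof.
by case/sub_edgeP=> a j jm; have [l1 l2] := label_node a jm; case=> -[-> ->]; rewrite l1 l2.
Qed.

(** Subdivision vertices lie strictly above the axis, and a coincidence on different edges would be
    a crossing at a cut point. *)
Lemma sub_vert_inj x y : px x = px y -> py x = py y -> x = y.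
Proof.
have int (i : 'I_mesh) : 0 < i.+1 <= mesh by rewrite /= ltn_ord.
case: x y => [u|[a i]] [v|[b j]] /= Ex Ey.
- by rewrite (pos_inj Ex).
- by have := trapezoid_gt0 (cutx_over b (int j)); lra.
- by have := trapezoid_gt0 (cutx_over a (int i)); lra.
- case: (eqVneq a b) => [ab|/eqP ne]; last first.
    case: (cutx_not_crossing (int i) ne); last by rewrite Ey Ex.
    by rewrite Ex; apply: cutx_over (int j).
  subst b; congr (inr (a, _)); apply/val_inj/eqP; rewrite -[_ == _]eqSS.
  apply/eqP; case: (ltngtP i.+1 j.+1) => // l.
    by have := @cutx_lt a i.+1 j.+1; rewrite l ltnS (ltnW (ltn_ord j)) => /(_ isT); lra.
  by have := @cutx_lt a j.+1 i.+1; rewrite l ltnS (ltnW (ltn_ord i)) => /(_ isT); lra.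
Qed.

Lemma sub_arc_avoid x y w t : sub_edge x y -> (0 < t < 1)%R ->
  ~ (arcx x y t = px w /\ arcy x y t = py w).
Proof.
case/sub_arcP=> a j jm _ Ey pc _ _ _ /pc {}pc [E1 E2]; rewrite Ey in E2.
have ov := in_piece_over jm pc.
case: w E1 E2 => [u|[b i]] /= E1 E2; first by have := trapezoid_gt0 ov; lra.
rewrite E1 in pc ov E2; case: (eqVneq a b) => [ab|/eqP ne].
  by subst b; apply: (in_piece_cutx jm _ pc); apply: leqW.
by apply: (@cutx_not_crossing b a i.+1) => //; rewrite /= ?ltn_ord //; apply: nesym.
Qed.

Lemma sub_arc_inj x y s t : sub_edge x y -> arcx x y s = arcx x y t -> s = t.
Proof. by case/sub_arcP=> a j _ _ _ _ _ _ ne; rewrite /arcx => H; nra. Qed.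

Lemma sub_arc_cont x y t : sub_edge x y ->
  continuity_pt (arcx x y) t /\ continuity_pt (arcy x y) t.
Proof.
case/sub_arcP=> a j _ _ Ey _ _ _ _.
have cx : continuity_pt (arcx x y) t.
  apply: derivable_continuous_pt; rewrite /arcx.
  by apply: derivable_pt_plus; [apply: derivable_pt_const|
    apply: derivable_pt_mult; [apply: derivable_pt_id|apply: derivable_pt_const]].
split=> //; apply: (@continuity_pt_ext (fun t => trapezoid a (arcx x y t))).
  by move=> s; rewrite Ey.
by apply: (continuity_pt_comp (arcx x y)) => //; apply: trapezoid_continuous.
Qed.

Definition sub_drawing : drawing sub_edge.
Proof.
refine (@Drawing subdivision sub_edge px py arcx arcy sub_vert_inj _ _ _ _ _ _).
- move=> x y /sub_arcP[a j _ _ Ey _ Ex _ _]; rewrite Ey Ex.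
  by have -> : arcx x y 0 = px x by rewrite /arcx; lra.
- move=> x y /sub_arcP[a j _ _ Ey _ _ Ex _]; rewrite Ey Ex.
  by have -> : arcx x y 1 = px y by rewrite /arcx; lra.
- by move=> x y t exy _; apply: sub_arc_cont.
- by move=> x y s t exy _ _ E _; apply: sub_arc_inj E.
- move=> x y t exy; have E : arcx y x t = arcx x y (1 - t) by rewrite /arcx; lra.
  by rewrite /arcy E (label_sym exy).
- exact: sub_arc_avoid.
Defined.

Lemma sub_drawing_one_planar : one_planar_drawing sub_drawing.
Proof.
move=> x y u w u' w' s s' exy [euw [ns [Hs [t [Ht [E1 E2]]]]]]
  [euw' [ns' [Hs' [t' [Ht' [E1' E2']]]]]]; rewrite /= in E1 E2 E1' E2'.
case: (sub_arcP exy) => a j jm Sa Ya Pa _ _ _.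
case: (sub_arcP euw) => b i im Sb Yb Pb _ _ _.
case: (sub_arcP euw') => c k km Sc Yc Pc _ _ _.
have {}Pa1 := Pa _ Hs; have {}Pa2 := Pa _ Hs'.
have {}Pb := Pb _ Ht; have {}Pc := Pc _ Ht'.
rewrite Ya Yb -E1 in E2; rewrite Ya Yc -E1' in E2'; rewrite -E1 in Pb; rewrite -E1' in Pc.
have same (p q p' q' v v' : subdivision) :
    same_edge p q v v' -> same_edge p q p' q' -> same_edge v v' p' q'.
  by rewrite /same_edge; case=> -[-> ->] [] [-> ->]; auto.
(* Open pieces of one edge are disjoint, so arcs of the same original edge that share an interior
   point are the same arc. *)
have nab : a <> b.
  move=> ab; subst b; have ij := in_piece_uniq im jm Pb Pa1; subst i.
  by apply: ns; apply: same Sb.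
have nac : a <> c.
  move=> ac; subst c; have kj := in_piece_uniq km jm Pc Pa2; subst k.
  by apply: ns'; apply: same Sc.
have [Ess bc] := crossing_uniq_in_piece jm nab nac Pa1 Pa2
  (in_piece_over im Pb) (in_piece_over km Pc) E2 E2'.
split; first exact: sub_arc_inj Ess.
subst c; rewrite -Ess in Pc; have ik := in_piece_uniq im km Pb Pc; subst k.
by apply: same Sc.
Qed.

Lemma subdivision_one_planar : finite_one_planar_graph sub_edge.
Proof.
split; last by exists sub_drawing; apply: sub_drawing_one_planar.
by split; [apply: sub_edge_sym | apply: sub_edge_irrefl].
Qed.

(** * Distances in the subdivision *)

Lemma sub_path_from_src a j : j <= mesh.+1 -> exists p,
  [/\ path sub_edge (inl (src a)) p, last (inl (src a)) p = node a j & size p = j].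
Proof.
elim: j => [|j IH] jm; first by exists [::].
have [p [pp lp sp]] := IH (ltnW jm); exists (rcons p (node a j.+1)).
rewrite rcons_path pp lp last_rcons size_rcons sp; split=> //=.
by apply/sub_edgeP; apply: (@SubEdge _ _ a j) => //; left.
Qed.

Lemma sub_path_to_src a j : j <= mesh.+1 -> exists p,
  [/\ path sub_edge (node a j) p, last (node a j) p = inl (src a) & size p = j].
Proof.
elim: j => [|j IH] jm; first by exists [::].
have [p [pp lp sp]] := IH (ltnW jm); exists (node a j :: p).
rewrite /= pp lp sp andbT; split=> //.
by apply/sub_edgeP; apply: (@SubEdge _ _ a j) => //; right.
Qed.

Lemma sub_dist_edge u v : symmetric e -> e u v -> u != v ->
  gdist_le sub_edge (inl u) (inl v) (INR mesh.+1).
Proof.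
move=> esym_e euv ne; case: (ltngtP (enum_rank u) (enum_rank v)) => [l|l|E].
- have P : (enum_rank (u, v).1 < enum_rank (u, v).2) && e (u, v).1 (u, v).2 by rewrite /= l.
  have [p [pp lp sp]] := sub_path_from_src (exist _ (u, v) P : oriented_edge) (leqnn _).
  by exists p; rewrite sp lp node_last; split=> //; split=> //; lra.
- have P : (enum_rank (v, u).1 < enum_rank (v, u).2) && e (v, u).1 (v, u).2
    by rewrite /= l esym_e.
  have [p [pp lp sp]] := sub_path_to_src (exist _ (v, u) P : oriented_edge) (leqnn _).
  by rewrite node_last in pp lp; exists p; rewrite sp lp; split=> //; split=> //; lra.
- by case/eqP: ne; apply/enum_rank_inj/val_inj.
Qed.

(** Interpolating [INR mesh.+1 * h] linearly along the subdivided edges gives a function that grows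
    by at most 1 per step. *)
Lemma sub_dist_lower (h : T -> R) u v D :
  (forall u v, e u v -> (-1 <= h v - h u <= 1)%R) ->
  gdist_le sub_edge (inl u) (inl v) D -> (INR mesh.+1 * (h v - h u) <= D)%R.
Proof.
move=> lip [p [pp [lp sp]]].
pose g (x : subdivision) : R := match x with inl w => INR mesh.+1 * h w
  | inr (a, i) => INR mesh.+1 * h (src a) + INR i.+1 * (h (tgt a) - h (src a)) end%R.
have gE a j : j <= mesh.+1 ->
    g (node a j) = (INR mesh.+1 * h (src a) + INR j * (h (tgt a) - h (src a)))%R.
  by case/(nodeP a)=> //=; rewrite ?INR_0; lra.
have glip x y : sub_edge x y -> (g y <= g x + 1)%R.
  case/sub_edgeP=> a j jm; have := lip _ _ (edge_src_tgt a) => L.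
  by case=> -[-> ->]; rewrite !gE ?(leqW jm) // (S_INR j); lra.
by have := path_lipschitz glip pp; rewrite lp /g; lra.
Qed.

End Subdivision.

(** * Words under king moves *)

Section King.

Variables (m : nat) (I : finType).
Implicit Types x y : {ffun I -> 'I_m.+1}.

(** The strong product of copies, indexed by [I], of the path on [m.+1] vertices. *)
Definition king : rel {ffun I -> 'I_m.+1} := fun x y =>
  (x != y) && [forall i, (x i <= (y i).+1) && (y i <= (x i).+1)].

Lemma king_sym : symmetric king.
Proof.
move=> x y; rewrite /king eq_sym; congr (_ && _).
by apply: eq_forallb => i; rewrite andbC.
Qed.

Lemma king_lipschitz i x y : king x y ->
  (-1 <= INR (y i) - INR (x i) <= 1)%R.
Proof.
case/andP=> _ /forallP /(_ i) /andP[/INR_leq H1 /INR_leq H2].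
by rewrite S_INR in H1; rewrite S_INR in H2; lra.
Qed.

Lemma king_line (l : {ffun I -> option 'I_m.+1}) (a b : 'I_m.+1) :
  active l -> nat_of_ord b = a.+1 -> king (subst_line l a) (subst_line l b).
Proof.
case/existsP=> i /eqP li ab; apply/andP; split.
  apply/eqP=> /ffunP /(_ i); rewrite !ffunE li /= => E.
  by move: ab; rewrite E => /n_Sn.
apply/forallP=> j; rewrite !ffunE; case: (l j) => [c|] /=; first by rewrite leqnSn.
by rewrite ab leqnn andbT; do 2!apply: leqW.
Qed.

End King.

(** * Covers against monochromatic lines *)

Lemma r_disjoint_walk (T : finType) (e : rel T) (r : R) (F : {set {set T}})
    (U : {set T}) (p : nat -> T) n :
  r_disjoint e r F -> (forall i, i <= n -> exists2 V, V \in F & p i \in V) ->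
  (forall i, i < n -> gdist_le e (p i) (p i.+1) r) ->
  U \in F -> p 0 \in U -> p n \in U.
Proof.
move=> dis cov; elim: n cov => // n IH cov step UF pU.
have pn : p n \in U.
  by apply: IH => // i lei; [apply: cov; apply: leqW | apply: step; apply: ltnW].
have [V VF pV] := cov n.+1 (leqnn _).
(* Otherwise [p n] and [p n.+1] would lie in different members at distance at most [r]. *)
have [->//|/eqP ne] := eqVneq U V.
by case: (dis U V _ _ UF VF ne pn pV); apply: step.
Qed.

Theorem theorem5p9 :
  forall k : nat, ~ AN_dim_le finite_one_planar_graph k.
Proof.
move=> k [c [c0 H]].
have [m cm] := INR_unbounded c.
have [I HI] := hales_jewett m 'I_k.+1.
pose e := @king m I; pose L := mesh e.
have L0 : (0 < INR L.+1)%R by apply: (@INR_ltn 0).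
(* The scale [INR L.+1] is the length of a subdivided edge, so steps along a line are too short to
   change members. *)
have [Fs [cov [dis bnd]]] := H _ _ (subdivision_one_planar e) _ L0.
(* A word is coloured by the index of a family covering it; the default [ord0] never occurs, by
   [cov]. *)
pose chi (w : {ffun I -> 'I_m.+1}) : 'I_k.+1 :=
  odflt ord0 [pick i | [exists U in Fs i, inl w \in U]].
have chiP w : exists2 U, U \in Fs (chi w) & inl w \in U.
  rewrite /chi; case: pickP => [i /exists_inP //|none].
  have [i [U [UF wU]]] := cov (inl w).
  by have /negP[] := negbT (none i); apply/exists_inP; exists U.
have [l [act mono]] := HI chi.
pose p i : subdivision e := inl (subst_line l (inord i)).
have [U UF p0U] := chiP (subst_line l (inord 0)).
have pmU : p m \in U.
  apply: (r_disjoint_walk (dis (chi (subst_line l (inord 0))))) UF p0U => i lei.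
    by rewrite (mono _ (inord i)); apply: chiP.
  have K : e (subst_line l (inord i)) (subst_line l (inord i.+1)).
    by apply: king_line => //; rewrite !inordK // ltnS // ltnW.
  by apply: sub_dist_edge => //; [apply: king_sym | case/andP: K].
(* At a moving coordinate the letter goes from 0 to [m], so the ends of the line are at least
   [m * INR L.+1] apart, more than [c * INR L.+1]. *)
have /existsP[i /eqP li] := act.
have := sub_dist_lower (h := fun w : {ffun I -> 'I_m.+1} => INR (w i)) (@king_lipschitz m I i)
  (bnd _ _ UF _ _ p0U pmU).
rewrite !ffunE li /= !inordK // INR_0 -/e -/L; nra.
Qed.
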